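(* Consider the one-hop wireless network model described in the context, where the channel powers $\gamma_{i,j}$ are i.i.d. with a distribution of NHT (super-exponential) type, i.e., $\mathbb{E}\{e^{s\gamma_{1,1}}\}<\infty$ for some $s>0$. Then the throughput of any one-hop scheme is upper bounded by $\mathrm{O}(\log n)$: there is a constant $C>0$ such that, with high probability, $T(\mathbb{S})\le C\log n$ for every choice of the active set $\mathbb{S}\subset\{S_1,\dots,S_n\}$.
   Context: Network model: $n$ sources $S_1,\dots,S_n$ and $n$ destinations $D_1,\dots,D_n$; $S_i$ wishes to communicate with $D_i$ in one hop. The channel power from $S_i$ to $D_j$ is $\gamma_{i,j}\ge0$; all $\gamma_{i,j}$ are i.i.d. with mean $\mu>0$. A subset $\mathbb{S}$ of sources is active, each with power $1$ (the others silent); $SINR_i=\frac{\gamma_{i,i}}{N_0+\sum_{S_k\in\mathbb{S},k\ne i}\gamma_{k,i}}$ for $S_i\in\mathbb{S}$ (and $0$ otherwise), with noise variance $N_0\ge0$; $D_i$ succeeds if $SINR_i>\beta$ for a fixed constant $\beta>0$. The throughput $T(\mathbb{S})$ is the number of successful destinations. Logarithms are natural. ''With high probability'' means with probability tending to $1$ as $n\to\infty$. *)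

(* Defs.v *)
From HB Require Import structures.
From mathcomp Require Import all_boot all_order all_algebra.
From mathcomp Require Import all_classical all_reals all_analysis.
Set Implicit Arguments. Unset Strict Implicit. Unset Printing Implicit Defensive.
Import Order.TTheory GRing.Theory Num.Theory.
Import numFieldNormedType.Exports.
Local Open Scope classical_set_scope.
Local Open Scope ring_scope.

(* Mutual independence of a finite family of real random variables:
   the joint law is the product of the marginals on every rectangle
   (taking B k = setT for unused indices gives every finite subfamily). *)
Definition mutually_independent d (T : measurableType d) (R : realType)
  (P : probability T R) (I : finType) (X : I -> T -> R) : Prop :=
  forall B : I -> set R, (forall k, measurable (B k)) ->
    P (\bigcap_(k in [set: I]) (X k @^-1` B k)) =
    (\big[*%E/1%E]_(k : I) P (X k @^-1` B k))%E.

Definition same_law d (T : measurableType d) (R : realType)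
  (P : probability T R) (X Y : T -> R) : Prop :=
  forall B : set R, measurable B -> P (X @^-1` B) = P (Y @^-1` B).

(* Network with n source/destination pairs; g i j = channel power from S_i to D_j.
   Interference at D_i from the active set S. *)
Definition interference (R : realType) (n : nat) (g : 'I_n -> 'I_n -> R)
  (S : {set 'I_n}) (i : 'I_n) : R :=
  \sum_(k in S | k != i) g k i.

(* SINR_i > beta, written as gamma_ii > beta (N0 + interference):
   identical to gamma_ii / (N0 + I) > beta when the denominator is positive,
   and the +oo-SINR convention when the denominator is 0. *)
Definition succeeds (R : realType) (n : nat) (g : 'I_n -> 'I_n -> R)
  (N0 beta : R) (S : {set 'I_n}) (i : 'I_n) : bool :=
  (i \in S) && (beta * (N0 + interference g S i) < g i i).

Definition throughput (R : realType) (n : nat) (g : 'I_n -> 'I_n -> R)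
  (N0 beta : R) (S : {set 'I_n}) : nat :=
  #|[set i | succeeds g N0 beta S i]|.

(* Main.v *)
(* By the exponential tail, with high probability every direct gain is at most
   L = (2 / s) log n. If k destinations then succeed, the k (k - 1) cross gains
   among them sum to less than k L / beta, so at most k L / (beta eps) of them
   reach eps = mu / 2. Since a gain reaches eps with probability p > 0,
   independence makes this exponentially unlikely in k (k - 1): the probability
   is at most 2 ^ (k L / (beta eps)) (1 - p / 2) ^ (k (k - 1)). For k a large
   multiple of log n this beats the at most n ^ k choices of destinations. *)

Require Import Defs.
From HB Require Import structures.
From mathcomp Require Import all_boot all_order all_algebra.
From mathcomp Require Import all_classical all_reals all_analysis.
From mathcomp Require Import measurable_realfun ring lra.
Import Order.TTheory GRing.Theory Num.Theory.
Import numFieldNormedType.Exports.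
Local Open Scope classical_set_scope.
Local Open Scope ring_scope.

(** * Finite families of events *)

Lemma union_bound (d : measure_display) (T : measurableType d) (R : realType)
    (P : probability T R) (I : finType) (Q : pred I) (F : I -> set T)
    (A : set T) :
  measurable A -> (forall i, Q i -> measurable (F i)) ->
  (forall w, A w -> exists2 i, Q i & F i w) ->
  (P A <= \sum_(i | Q i) P (F i))%E.
Proof.
move=> mA mF AF.
have mU : measurable (\big[setU/set0]_(i | Q i) F i).
  exact: bigsetU_measurable.
apply: (@le_trans _ _ (P (\big[setU/set0]_(i | Q i) F i))).
  apply: le_measure; rewrite ?inE// => w /AF [i Qi Fi].
  by rewrite (bigD1 i) //=; left.
suff [] : measurable (\big[setU/set0]_(i | Q i) F i) /\
  (P (\big[setU/set0]_(i | Q i) F i) <= \sum_(i | Q i) P (F i))%E by [].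
apply: (big_ind2 (fun B x => measurable B /\ (P B <= x)%E)).
- by rewrite measure0.
- move=> B x C y [mB Bx] [mC Cy]; split; first exact: measurableU.
  by apply: (le_trans (measureU2 _ mB mC)); exact: leeD.
- by move=> i Qi; split=> //; exact: mF.
Qed.

(** A finite random set takes finitely many values: the event is the union, over the accepted [J],
    of the events that the pattern equals [J]. *)
Lemma measurable_pattern (d : measure_display) (T : measurableType d)
    (I : finType) (b : I -> T -> bool) (Q : {set I} -> bool) :
  (forall i, measurable [set w | b i w]) ->
  measurable [set w | Q [set i | b i w]%SET].
Proof.
move=> mb.
have -> : [set w | Q [set i | b i w]%SET] =
    \bigcup_(J in [set J | Q J])
      \bigcap_(i in [set: I]) [set w | b i w = (i \in J)].
  apply/seteqP; split=> [w Qw|w [J QJ bJ]] /=.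
    by exists [set i | b i w]%SET => //= i _ /=; rewrite inE.
  rewrite (_ : [set i | b i w]%SET = J) //.
  by apply/setP => i; rewrite inE; exact: bJ.
apply: fin_bigcup_measurable => // J _; apply: fin_bigcap_measurable => // i _.
case: (i \in J); first exact: mb.
rewrite (_ : [set w | _] = ~` [set w | b i w]); first exact: measurableC.
by apply/seteqP; split=> w /=; case: (b i w).
Qed.

(* Markov's inequality for [2 ^- card]: a pattern [J] with at most [m] elements
   has weight at most [2 ^+ m * 2 ^- #|J|], and summing [2 ^- #|J| * P (E J)]
   over all patterns factors into the product on the right. *)
Lemma card_le_independent (d : measure_display) (T : measurableType d)
    (R : realType) (P : probability T R) (I : finType) (X : I -> {RV P >-> R})
    (B : I -> set R) (p : I -> R) (m : nat) :
  mutually_independent P (fun i => X i : T -> R) ->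
  (forall i, measurable (B i)) ->
  (forall i, P (X i @^-1` B i) = (p i)%:E) ->
  (P [set w | (#|[set i | X i w \in B i]%SET| <= m)%N] <=
     (2 ^+ m * \prod_i (1 - p i / 2))%:E)%E.
Proof.
move=> ind mB pB.
have mXB i : measurable (X i @^-1` B i) by exact: measurable_funPTI.
have p01 i : 0 <= p i <= 1.
  by rewrite -!lee_fin -pB measure_ge0 probability_le1.
(* Complementing the sets off [J] makes [E J], the event that the pattern is exactly [J], a
   rectangle to which independence applies. *)
pose BJ (J : {set I}) i := if i \in J then B i else ~` B i.
have mBJ J i : measurable (BJ J i).
  by rewrite /BJ; case: ifP => _; [exact: mB|exact/measurableC].
pose E J := \bigcap_(i in [set: I]) (X i @^-1` BJ J i).
have mE J : measurable (E J).
  by apply: fin_bigcap_measurable => // i _; exact: measurable_funPTI.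
have PE J : P (E J) = (\prod_i (if i \in J then p i else 1 - p i))%:E.
  rewrite /E ind // -prodEFin; apply: eq_bigr => i _.
  rewrite /BJ; case: ifP => _; first exact: pB.
  by rewrite -preimage_setC probability_setC // pB.
apply: (@le_trans _ _ (\sum_(J : {set I} | (#|J| <= m)%N) P (E J))%E).
  apply: union_bound => //.
    apply: (@measurable_pattern _ _ _ (fun i w => X i w \in B i)
      (fun J => (#|J| <= m)%N)) => i.
    rewrite (_ : [set w | _] = X i @^-1` B i) //.
    by apply/seteqP; split=> w /=; rewrite inE.
  move=> w /= Jm; exists [set i | X i w \in B i]%SET => // i _ /=.
  by rewrite /BJ inE; case: ifPn; rewrite ?inE// notin_setE.
rewrite (eq_bigr _ (fun J _ => PE J)) sumEFin lee_fin.
have -> : \prod_i (1 - p i / 2) = \prod_i (p i / 2 + (1 - p i)).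
  by apply: eq_bigr => i _; field.
rewrite bigA_distr big_distrr /=.
rewrite [leRHS](bigID (fun J : {set I} => (#|J| <= m)%N)) /=.
apply: ler_wpDr.
  apply: sumr_ge0 => J _; rewrite mulr_ge0 ?exprn_ge0//.
  by apply: prodr_ge0 => i _; have := p01 i; case: ifP => _; lra.
apply: ler_sum => J Jm.
have -> : \prod_i (if i \in J then p i / 2 else 1 - p i) =
    2 ^- #|J| * \prod_i (if i \in J then p i else 1 - p i) :> R.
  rewrite [in RHS](bigID (mem J)) [in LHS](bigID (mem J)) /= mulrA.
  congr (_ * _); last by apply: eq_bigr => i /negbTE ->.
  rewrite -exprVn -prodr_const -big_split /=.
  by apply: eq_bigr => i ->; rewrite mulrC.
rewrite mulrA ler_peMl //.
  by apply: prodr_ge0 => i _; have := p01 i; case: ifP => _; lra.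
by rewrite ler_pdivlMr ?exprn_gt0// mul1r ler_weXn2l // ler1n.
Qed.

(** * Law and tail of a single gain *)

Lemma set_ge_preimage (R : realType) (T : Type) (Y : T -> R) (a : R) :
  [set w | a <= Y w] = Y @^-1` `[a, +oo[%classic.
Proof. by apply/seteqP; split=> w /=; rewrite in_itv /= andbT. Qed.

Lemma measurable_RV_ge (d : measure_display) (T : measurableType d)
    (R : realType) (P : probability T R) (Y : {RV P >-> R}) (a : R) :
  measurable [set w | a <= Y w].
Proof. by rewrite set_ge_preimage; exact: measurable_funPTI. Qed.

Lemma same_law_ge (d : measure_display) (T : measurableType d)
    (R : realType) (P : probability T R) (X Y : T -> R) (a : R) :
  same_law P X Y -> P [set w | (a <= X w)%R] = P [set w | (a <= Y w)%R].
Proof.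
move=> XY; rewrite (set_ge_preimage _ _ X) (set_ge_preimage _ _ Y).
exact: XY.
Qed.

(** Otherwise [X < mu / 2] almost surely, which would force the mean down to [mu / 2]. *)
Lemma measure_ge_half_mean_gt0 (d : measure_display) (T : measurableType d)
    (R : realType) (P : probability T R) (X : {RV P >-> R}) (mu : R) :
  0 < mu -> (forall w, 0 <= X w) -> ('E_P[X] = mu%:E)%E ->
  (0 < P [set w | (mu / 2 <= X w)%R])%E.
Proof.
move=> mu0 X0 EX; rewrite lt0e measure_ge0 andbT; apply/eqP => P0.
have mA := @measurable_RV_ge _ _ _ _ X (mu / 2).
suff : (mu%:E <= (mu / 2)%:E)%E by rewrite lee_fin; lra.
rewrite -EX unlock.
have -> : (mu / 2)%:E = (\int[P]_w (cst (mu / 2)%:E w))%E.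
  by rewrite integral_cst //= probability_setT mule1.
apply: ae_ge0_le_integral => //.
- by move=> w _; rewrite lee_fin.
- by apply/measurable_EFinP.
- by move=> w _ /=; rewrite lee_fin; lra.
exists [set w | mu / 2 <= X w]; split=> // w /=.
move=> h; rewrite leNgt; apply/negP => lt; apply: h => _.
by rewrite lee_fin ltW.
Qed.

(** Chernoff's bound at the fixed parameter [s]; [M] is the moment generating function there. *)
Lemma exponential_tail (d : measure_display) (T : measurableType d)
    (R : realType) (P : probability T R) (X : {RV P >-> R}) (s : R) :
  0 < s -> ('E_P[fun w => expR (s * X w)] < +oo)%E ->
  exists2 M : R, 0 <= M &
    forall a, (P [set w | (a <= X w)%R] <= (M * expR (- (s * a)))%:E)%E.
Proof.
move=> s0 Efin.
have E0 : (0 <= 'E_P[fun w => expR (s * X w)])%E.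
  by apply: expectation_ge0 => w; exact: expR_ge0.
exists (fine 'E_P[fun w => expR (s * X w)]); first exact: fine_ge0.
move=> a; apply: (le_trans (chernoff X a s0)).
rewrite EFinM fineK ?ge0_fin_numE// /mmt_gen_fun.
rewrite (_ : expR \o _ = fun w => expR (s * X w)) //.
by apply/funext => w /=; rewrite mulrC.
Qed.

(** * Successes force few large cross gains *)

Lemma throughputE (R : realType) (n : nat) (g : 'I_n -> 'I_n -> R)
    (N0 beta : R) (S : {set 'I_n}) :
  throughput g N0 beta S = #|[set i | succeeds g N0 beta S i]%SET|.
Proof.
by apply: eq_card => i; rewrite !inE /in_mem /=; apply/asboolP/idP.
Qed.

(** For any [k] successful destinations [A], the interference reaching each from within [A] is at
    most [L / beta], and every gain of at least [eps] uses up [eps] of it. Summing over the [k]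
    columns gives the count. *)
Lemma many_successes_few_large_gains (R : realType) (n k : nat)
    (g : 'I_n -> 'I_n -> R) (N0 beta eps L : R) (S : {set 'I_n}) :
  0 <= N0 -> 0 < beta -> 0 < eps -> (forall i j, 0 <= g i j) ->
  (forall i, g i i <= L) -> (k <= throughput g N0 beta S)%N ->
  exists2 A : {set 'I_n}, #|A| = k &
    (#|[set q : 'I_n * 'I_n | [&& q.1 \in A, q.2 \in A, q.1 != q.2
        & eps <= g q.1 q.2]]%SET|)%:R <= k%:R * (L / (beta * eps)).
Proof.
rewrite throughputE => N0_ge0 beta0 eps0 g0 gL /card_geqP [s [us sk sS]].
pose A := [set i in s]%SET; exists A; first by rewrite cardsE (card_uniqP us).
have AS i : i \in A -> succeeds g N0 beta S i.
  by rewrite inE => /sS; rewrite inE.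
have col i : i \in A -> eps * \sum_(j in A | j != i) (eps <= g j i)%R%:R
    <= L / beta.
  move=> iA; rewrite ler_pdivlMr// mulrC.
  have /andP[_ /ltW succ_i] := AS _ iA.
  apply: le_trans (le_trans succ_i (gL i)); rewrite ler_pM2l// /interference.
  apply: ler_wpDl => //; rewrite mulr_sumr.
  apply: (@le_trans _ _ (\sum_(j in A | j != i) g j i)).
    apply: ler_sum => j _.
    by case: (leP eps (g j i)) => h; rewrite /= ?mulr1 ?mulr0.
  (* Interferers outside [A] are dropped; what remains runs over all of [A] but [i], as successful
     sources belong to [S]. *)
  rewrite [leRHS](bigID (mem A)) /=; apply: ler_wpDr.
    by apply: sumr_ge0 => j _.
  rewrite le_eqVlt; apply/orP; left; apply/eqP; apply: eq_bigl => j.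
  have := AS j; case: (j \in A) => //= [/(_ isT)/andP[-> _]|_];
    by rewrite ?andbT ?andbF.
have -> : (#|[set q : 'I_n * 'I_n | [&& q.1 \in A, q.2 \in A, q.1 != q.2
        & eps <= g q.1 q.2]]%SET|)%:R =
    \sum_(i in A) \sum_(j in A | j != i) (eps <= g j i)%R%:R :> R.
  rewrite -sum1_card natr_sum (exchange_big_dep (mem A)) /=; last first.
    by move=> i j _ /andP[].
  rewrite pair_big_dep /= [LHS]big_mkcond [RHS]big_mkcond /=.
  apply: eq_bigr => -[i j] _ /=; rewrite inE /=.
  by case: (i \in A); case: (j \in A); case: (i != j); case: (eps <= g i j).
rewrite -(@ler_pM2l _ eps)// mulr_sumr (le_trans (ler_sum _ col)) //.
rewrite sumr_const cardsE (card_uniqP us) sk -[leLHS]mulr_natl.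
rewrite [leRHS](_ : _ = k%:R * (L / beta)) //.
by field; rewrite !gt_eqF.
Qed.

(** * Decay of the union bound *)

Lemma bin_leq_exp (n k : nat) : ('C(n, k) <= n ^ k)%N.
Proof.
apply: (@leq_trans (n ^_ k)); first by rewrite -bin_ffact leq_pmulr ?fact_gt0.
elim: k => [|k IHk]; first by rewrite ffactn0.
by rewrite ffactnSr expnSr leq_mul // leq_subr.
Qed.

Lemma card_offdiag (I : finType) (A : {set I}) :
  #|[set q : I * I | [&& q.1 \in A, q.2 \in A & q.1 != q.2]]%SET| =
  (#|A| * #|A|.-1)%N.
Proof.
rewrite -sum1_card.
under eq_bigl do rewrite inE.
rewrite -(pair_big_dep (mem A) (fun i j => (j \in A) && (i != j))
  (fun _ _ => 1%N)) /= -sum_nat_const.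
apply: eq_bigr => i iA; rewrite sum1dep_card (cardsD1 i A) iA /=.
by apply: eq_card => j; rewrite !inE andbC eq_sym.
Qed.

(** With [l = ln n], the three factors are at most the exponentials of [k l], [k b l] and
    [- k (k - 1) p / 2]. The last hypothesis puts the final exponent below [- k (b + 2) l]: [b + 1]
    of it cancels the growth and the rest gives [1 / n]. *)
Lemma union_bound_decay (R : realType) (n k m : nat) (b p : R) :
  0 <= b -> 0 <= p <= 1 -> 1 <= ln n%:R :> R -> (0 < k)%N ->
  m%:R <= k%:R * (b * ln n%:R) -> b + 2 <= p / 2 * (k.-1%:R / ln n%:R) ->
  'C(n, k)%:R * (2 ^+ m * (1 - p / 2) ^+ (k * k.-1)) <= n%:R^-1 :> R.
Proof.
move=> b0 p01 l1 k0 mk bk.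
have n0 : 0 < n%:R :> R.
  rewrite ltNge; apply/negP => n0; move: l1; rewrite ln0 //; lra.
have l0 : 0 < ln n%:R :> R by lra.
set l := ln n%:R in l1 mk bk l0 *.
have En : n%:R = expR l by rewrite /l lnK // posrE.
have e2 : (2 : R) <= expR 1 by have := @expR_ge1Dx R 1; lra.
have hC : 'C(n, k)%:R <= expR (k%:R * l).
  by rewrite expRM_natl -En -natrX ler_nat bin_leq_exp.
have hm : 2 ^+ m <= expR (k%:R * (b * l)).
  apply: (@le_trans _ _ (expR (m%:R * 1))).
    by rewrite expRM_natl lerXn2r ?nnegrE ?expR_ge0.
  by rewrite ler_expR mulr1.
have hp : (1 - p / 2) ^+ (k * k.-1) <= expR ((k * k.-1)%:R * - (p / 2)).
  rewrite expRM_natl lerXn2r ?nnegrE ?expR_ge0 //; first by lra.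
  exact: expR_ge1Dx.
have hp0 : 0 <= (1 - p / 2) ^+ (k * k.-1) by rewrite exprn_ge0 //; lra.
apply: (@le_trans _ _ (expR (k%:R * l) *
    (expR (k%:R * (b * l)) * expR ((k * k.-1)%:R * - (p / 2))))).
  apply: ler_pM => //; first by apply: mulr_ge0 => //; exact: exprn_ge0.
  by apply: ler_pM => //; exact: exprn_ge0.
rewrite -!expRD En -expRN ler_expR natrM.
have k1 : 1 <= k%:R :> R by rewrite ler1n.
have kl : (b + 2) * l <= p / 2 * k.-1%:R.
  by move: bk; rewrite mulrA ler_pdivlMr.
have : k%:R * ((b + 2) * l) <= k%:R * (p / 2 * k.-1%:R).
  by rewrite ler_wpM2l.
have : l <= k%:R * l by rewrite ler_peMl // ltW.
lra.
Qed.

(** Since [harmonic n] is [1 / (n + 1)], the shift costs a factor of at most [2]. *)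
Lemma inv_le_harmonic (R : realType) (n : nat) :
  (0 < n)%N -> n%:R^-1 <= 2 * harmonic n :> R.
Proof.
move=> n0; have n1 : 1 <= n%:R :> R by rewrite ler1n.
rewrite /harmonic /= ler_pdivlMr // mulrC ler_pdivrMr ?ltr0n // -natr1.
lra.
Qed.

(** * Tail bound for fixed [n] *)

(** The bad event, with an integer threshold: for [k] the least integer above [C * ln n], its
    complement is the event of the theorem. *)
Definition throughput_reaches (R : realType) (T : Type) (n : nat)
    (gamma : 'I_n -> 'I_n -> T -> R) (N0 beta : R) (k : nat) : set T :=
  [set w | exists S : {set 'I_n},
    (k <= throughput (fun i j => gamma i j w) N0 beta S)%N].
Arguments throughput_reaches {R T n}.

Section throughput_tail.
Context (d : measure_display) (T : measurableType d) (R : realType).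
Context (P : probability T R) (X : {RV P >-> R}) (n : nat).
Context (gamma : 'I_n -> 'I_n -> {RV P >-> R}) (N0 beta : R).

Lemma measurable_throughput_reaches (k : nat) :
  measurable (throughput_reaches gamma N0 beta k).
Proof.
rewrite (_ : throughput_reaches _ _ _ _ = \bigcup_(S in [set: {set 'I_n}])
    [set w | (k <= #|[set i | succeeds (fun i j => gamma i j w)
      N0 beta S i]%SET|)%N]); last first.
  apply/seteqP; split=> w /=.
    by case=> S; rewrite throughputE => kS; exists S.
  by case=> S _ /= kS; exists S; rewrite throughputE.
apply: fin_bigcup_measurable => // S _.
apply: (@measurable_pattern _ _ _
  (fun i w => succeeds (fun i j => gamma i j w) N0 beta S i)
  (fun J => (k <= #|J|)%N)) => i.
rewrite /succeeds; case: (i \in S) => /=; last first.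
  by rewrite (_ : [set w | _] = set0) //; apply/seteqP; split.
rewrite /interference -[X in measurable X]setTI.
pose f w := beta * (N0 + \sum_(j in S | j != i) gamma j i w).
suff mf : measurable_fun setT f.
  exact: (measurable_fun_ltr mf (measurable_funPT (gamma i i))).
apply: measurable_funM => //; apply: measurable_funD => //.
under eq_fun do rewrite big_mkcond.
by apply: measurable_sum => j; case: (_ && _).
Qed.

Context (X_ge0 : forall w, 0 <= X w).
Context (gamma_law : forall i j, same_law P (gamma i j) X).
Context (gamma_ind : mutually_independent P
  (fun q : 'I_n * 'I_n => (gamma q.1 q.2 : T -> R))).

(** The gains are tied to [X] only through their law, so they are nonnegative almost surely rather
    than pointwise; negative values enter the union bound as null events. *)
Lemma gamma_lt0 i j : P [set w | (gamma i j w < 0)%R] = 0%E.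
Proof.
have -> : [set w | (gamma i j w < 0)%R] = ~` [set w | (0 <= gamma i j w)%R].
  by apply/seteqP; split=> w /=; rewrite ltNge => /negP.
rewrite probability_setC; last exact: measurable_RV_ge.
rewrite (same_law_ge _ _ _ _ _ _ _ (gamma_law i j)).
rewrite (_ : [set w | _] = setT) ?probability_setT ?subee //.
by apply/seteqP; split=> w //=.
Qed.

(** Three kinds of failure are united: a negative gain, of probability zero; a direct gain reaching
    [L], of total cost at most [n q]; and a set of [k] destinations with at most [m] large cross
    gains, bounded by independence. *)
Lemma throughput_reaches_le (k m : nat) (eps p L q : R) :
  0 <= N0 -> 0 < beta -> 0 < eps ->
  P [set w | (eps <= X w)%R] = p%:E -> (P [set w | (L <= X w)%R] <= q%:E)%E ->
  k%:R * (L / (beta * eps)) < m.+1%:R ->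
  (P (throughput_reaches gamma N0 beta k) <=
    (n%:R * q + 'C(n, k)%:R * (2 ^+ m * (1 - p / 2) ^+ (k * k.-1)))%:E)%E.
Proof.
move=> N0_ge0 beta0 eps0 Pp Pq km.
pose D (A : {set 'I_n}) (x : 'I_n * 'I_n) :=
  [&& x.1 \in A, x.2 \in A & x.1 != x.2].
(* Taking [set0] off the pairs of [A] makes their factor in
   [card_le_independent] equal to [1]. *)
pose B A x : set R := if D A x then `[eps, +oo[%classic else set0.
have mB A x : measurable (B A x) by rewrite /B; case: ifP.
pose few A :=
  [set w | (#|[set x | gamma x.1 x.2 w \in B A x]%SET| <= m)%N].
pose large i := [set w | L <= gamma i i w].
pose neg (x : 'I_n * 'I_n) := [set w | gamma x.1 x.2 w < 0].
have mneg x : measurable (neg x).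
  rewrite (_ : neg x = ~` [set w | 0 <= gamma x.1 x.2 w]).
    exact/measurableC/measurable_RV_ge.
  by apply/seteqP; split=> w /=; rewrite /neg /= ltNge => /negP.
have mlarge i : measurable (large i) by exact: measurable_RV_ge.
have mfew A : measurable (few A).
  apply: (@measurable_pattern _ _ _ (fun x w => gamma x.1 x.2 w \in B A x)
    (fun J => (#|J| <= m)%N)) => x.
  rewrite (_ : [set w | _] = gamma x.1 x.2 @^-1` B A x).
    exact: measurable_funPTI.
  by apply/seteqP; split=> w /=; rewrite inE.
(* One sum type indexes all three kinds of failure, and [Q] keeps only the sets of size [k]. *)
pose ev (x : 'I_n * 'I_n + ('I_n + {set 'I_n})) : set T :=
  match x with
  | inl y => neg y | inr (inl i) => large i | inr (inr A) => few A
  end.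
pose Q (x : 'I_n * 'I_n + ('I_n + {set 'I_n})) : bool :=
  if x is inr (inr A) then #|A| == k else true.
apply: (@le_trans _ _ (\sum_(x | Q x) P (ev x))%E).
  apply: union_bound; first exact: measurable_throughput_reaches.
    by case=> [y|[i|A]] _ /=.
  move=> w [S kS].
  have [[y yneg]|noneg] := pselect (exists y, neg y w); first by exists (inl y).
  have [[i il]|nolarge] := pselect (exists i, large i w).
    by exists (inr (inl i)).
  have g0 i j : 0 <= gamma i j w.
    by rewrite leNgt; apply/negP => gij; apply: noneg; exists (i, j).
  have gL i : gamma i i w <= L.
    apply: ltW; rewrite ltNge; apply/negP => gi.
    by apply: nolarge; exists i.
  have [A Ak cA] := many_successes_few_large_gains _ _ _ _ _ _ _ _ _
    N0_ge0 beta0 eps0 g0 gL kS.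
  exists (inr (inr A)); rewrite /= ?Ak ?eqxx // /few /=.
  (* The count is an integer strictly below [m + 1], hence at most [m]. *)
  rewrite -ltnS -(ltr_nat R); apply: le_lt_trans km; apply: le_trans cA.
  rewrite ler_nat; apply: subset_leq_card; apply/fintype.subsetP => x.
  rewrite !inE /B /D; case: ifP => [/and3P[-> -> ->]|_] /=.
    by rewrite in_itv /= andbT.
  by [].
rewrite big_sumType /= big1; last by move=> y _; exact: gamma_lt0.
rewrite add0e big_sumType /= EFinD; apply: leeD.
  apply: (@le_trans _ _ (\sum_(i < n) q%:E)%E).
    apply: lee_sum => i _.
    by rewrite /large (same_law_ge _ _ _ _ _ _ _ (gamma_law i i)).
  by rewrite sumEFin sumr_const card_ord mulr_natl.
apply: (@le_trans _ _ (\sum_(A : {set 'I_n} | #|A| == k)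
    (2 ^+ m * (1 - p / 2) ^+ (k * k.-1))%:E)%E).
  apply: lee_sum => A /eqP Ak.
  apply: (le_trans (@card_le_independent _ _ _ _ _ (fun x => gamma x.1 x.2)
    (B A) (fun x => if D A x then p else 0) m gamma_ind (mB A) _)).
    move=> x; rewrite /B; case: ifP => _; last first.
      by rewrite preimage_set0 measure0.
    by rewrite -set_ge_preimage (same_law_ge _ _ _ _ _ _ _ (gamma_law _ _)).
  rewrite lee_fin -Ak -card_offdiag -prodr_const.
  rewrite [X in _ * X <= _](bigID (D A)) /= [X in _ * (_ * X)]big1 ?mulr1.
    rewrite le_eqVlt; apply/orP; left; apply/eqP; congr (_ * _).
    by apply: eq_big => [x|x ->] //; rewrite inE.
  by move=> x /negbTE ->; rewrite mul0r subr0.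
rewrite sumEFin sumr_const lee_fin mulr_natl.
by rewrite -[n in 'C(n, k)]card_ord -card_draws cardsE.
Qed.

End throughput_tail.

(** * Choice of constants and passage to the limit *)

Theorem theorem2 (d : measure_display) (T : measurableType d) (R : realType)
  (P : probability T R)
  (X : {RV P >-> R})
  (gamma : forall n : nat, 'I_n -> 'I_n -> {RV P >-> R})
  (mu N0 beta : R)
  (hmu : 0 < mu) (hN0 : 0 <= N0) (hbeta : 0 < beta)
  (hXnn : forall w, 0 <= X w)
  (hXmean : ('E_P[X] = mu%:E)%E)
  (hNHT : exists2 s : R, 0 < s & ('E_P[fun w => expR (s * X w)] < +oo)%E)
  (hlaw : forall n (i j : 'I_n), same_law P (gamma n i j) X)
  (hind : forall n, mutually_independent P
            (fun p : 'I_n * 'I_n => (gamma n p.1 p.2 : T -> R))) :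
  exists2 C : R, 0 < C &
    (fun n : nat =>
       P [set w | forall S : {set 'I_n},
            ((throughput (fun i j => gamma n i j w) N0 beta S)%:R : R)
              <= C * ln (n%:R : R)])
    @ \oo --> 1%E.
Proof.
have [s s0 Efin] := hNHT.
have [M M0 tail] := exponential_tail _ _ _ P X s s0 Efin.
have eps0 : 0 < mu / 2 by lra.
have Ppos := measure_ge_half_mean_gt0 _ _ _ P X mu hmu hXnn hXmean.
set eps := mu / 2 in eps0 Ppos.
have Ple1 : (P [set w | (eps <= X w)%R] <= 1)%E.
  exact/probability_le1/measurable_RV_ge.
have [p Pp] : exists p : R, P [set w | (eps <= X w)%R] = p%:E.
  exists (fine (P [set w | (eps <= X w)%R])); rewrite fineK //.
  by rewrite ge0_fin_numE //; exact: le_lt_trans (ltry 1).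
have p0 : 0 < p by rewrite -lte_fin -Pp.
have p1 : p <= 1 by rewrite -lee_fin -Pp.
(* With [L = (2 / s) ln n], the quotient [L / (beta eps)] equals [b ln n]. *)
pose b := 2 / s / (beta * eps).
have b0 : 0 <= b by rewrite /b !divr_ge0 ?mulr_ge0 // ltW.
(* This gives [p / 2 * (C - 1) = b + 2], as [union_bound_decay] requires; the extra [1] absorbs the
   rounding of [C ln n] down to [k - 1], since [ln n >= 1]. *)
pose C := 2 * (b + 2) / p + 1.
have C0 : 0 < C.
  by rewrite /C addr_gt0 // divr_gt0 // mulr_gt0 //; lra.
exists C => //.
(* The failure probability will be at most [M / n] from the direct gains plus [1 / n] from the sets
   of destinations, and [1 / n <= 2 * harmonic n]. *)
have cvg_lower : (1 - (M + 1) * 2 * harmonic n)%:E @[n --> \oo] --> (1 : R)%:E.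
  apply: cvg_EFin; first by near=> n.
  rewrite -[X in _ --> X]subr0 -[X in _ - X](mulr0 ((M + 1) * 2)).
  apply: cvgB; first exact: cvg_cst.
  by apply: cvgMr; exact: cvg_harmonic.
apply: (squeeze_cvge _ cvg_lower (cvg_cst _)).
near=> n.
have ne : expR 1 <= n%:R :> R by near: n; exact: nbhs_infty_ger.
have n0 : 0 < n%:R :> R by apply: lt_le_trans ne; exact: expR_gt0.
have l1 : 1 <= ln n%:R :> R.
  by rewrite -[X in X <= _](@expRK R) ler_ln ?posrE ?expR_gt0.
set l := ln n%:R in l1 *.
have En : n%:R = expR l by rewrite /l lnK // posrE.
pose k := (Num.truncn (C * l)).+1.
have Cl0 : 0 <= C * l by rewrite mulr_ge0 //; lra.
have -> : [set w | forall S : {set 'I_n},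
    (throughput (fun i j => gamma n i j w) N0 beta S)%:R <= C * l] =
    ~` throughput_reaches (fun i j => gamma n i j : T -> R) N0 beta k.
  apply/seteqP; split=> w /=.
    by move=> wS [S]; apply/negP; rewrite -ltnNge ltnS truncn_ge_nat //.
  move=> wS S; rewrite -truncn_ge_nat // -ltnS ltnNge; apply/negP => kS.
  by apply: wS; exists S.
have mreach := measurable_throughput_reaches _ _ _ P n (gamma n) N0 beta k.
apply/andP; split; last exact/probability_le1/measurableC.
rewrite probability_setC //.
(* The number [m] of large gains allowed is the integer part of [k b l]. *)
have mk : k%:R * (2 / s * l / (beta * eps)) <
    (Num.truncn (k%:R * (b * l))).+1%:R.
  by rewrite [X in X < _](_ : _ = k%:R * (b * l)) ?truncnS_gt // /b; ring.
have := throughput_reaches_le _ _ _ P X n (gamma n) N0 beta hXnn (hlaw n)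
  (hind n) k _ eps p (2 / s * l) _ hN0 hbeta eps0 Pp (tail _) mk.
have decay : 'C(n, k)%:R * (2 ^+ Num.truncn (k%:R * (b * l)) *
    (1 - p / 2) ^+ (k * k.-1)) <= n%:R^-1 :> R.
  apply: (@union_bound_decay _ _ _ _ b) => //.
  - by rewrite ltW.
  - by rewrite truncn_le mulr_ge0 // mulr_ge0 // (le_trans ler01).
  have : C - 1 <= k.-1%:R / l.
    rewrite ler_pdivlMr; last by lra.
    have := truncnS_gt (C * l); rewrite -/k -[k]/(k.-1.+1) -natr1; lra.
  move=> /(ler_wpM2l (_ : 0 <= p / 2)) h.
  apply: le_trans (h _); last by lra.
  by rewrite /C le_eqVlt; apply/orP; left; apply/eqP; field; rewrite gt_eqF.
(* The factor [2] in [L] makes each tail at most [M / n ^ 2], so that [n] direct gains together cost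
   only [M / n]. *)
have tailn : n%:R * (M * expR (- (s * (2 / s * l)))) = M * n%:R^-1.
  have -> : s * (2 / s * l) = l + l by field; rewrite gt_eqF.
  by rewrite En opprD expRD !expRN; field; rewrite gt_eqF ?expR_gt0.
rewrite tailn => hP.
rewrite EFinB; apply: leeB => //; apply: le_trans hP _; rewrite lee_fin.
apply: le_trans (lerD (lexx _) decay) _.
rewrite -[X in _ + X]mul1r -mulrDl -mulrA ler_wpM2l ?addr_ge0 //.
by rewrite inv_le_harmonic // -(ltr0n R).
Unshelve. all: by end_near.
Qed.
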